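(* Let $q=1-p=o\!\left(\frac1n\right)$ and $qn^{1.5}\to\infty$ as $n\to\infty$. Then for all sufficiently large $n\in\mathbb{N}$ we have $u_2(n,p)=u_2'(n,p)=4$.
   Context: $G(n,p)$ is the Erdős–Rényi random graph on $n$ labelled vertices (vertex set $V$), each edge present independently with probability $p=p(n)$; $\mathbb{P}_{n,p}$ is the corresponding probability and $q=1-p$. A diameter graph in $\mathbb{R}^d$ is a graph $(V,E)$ with $V\subset\mathbb{R}^d$ finite and $E=\{\{\mathbf{x},\mathbf{y}\}\subseteq V: |\mathbf{x}-\mathbf{y}|=\operatorname{diam}V\}$, where $\operatorname{diam}V=\max_{\mathbf{x},\mathbf{y}\in V}|\mathbf{x}-\mathbf{y}|$ (Euclidean norm); a graph is a diameter graph in $\mathbb{R}^d$ if it is isomorphic to one. $u_d(n,p)$ is the largest positive integer $k$ such that $\mathbb{P}_{n,p}\big(\exists W\subseteq V,\ |W|=k,\ G[W]$ is a diameter graph in $\mathbb{R}^d$ and $\chi(G[W])=d+1\big)>\frac12$, where $G[W]$ is the induced subgraph; if no such $k$ exists, $u_d(n,p)=0$. $u_d'(n,p)$ is defined identically with the additional requirement that $G[W]$ be connected. *)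

(* Defs.v *)
From mathcomp Require Import all_boot.
From Stdlib Require Import Reals ClassicalEpsilon.
Set Implicit Arguments. Unset Strict Implicit. Unset Printing Implicit Defensive.

Definition pairs (n : nat) : {set {set 'I_n}} := [set e : {set 'I_n} | #|e| == 2].

Definition adj (n : nat) (E : {set {set 'I_n}}) (x y : 'I_n) : bool :=
  (x != y) && ([set x; y] \in E).

Definition point (d : nat) := 'I_d -> R.
Definition edist (d : nat) (a b : point d) : R :=
  sqrt (\big[Rplus/0%R]_(i < d) ((a i - b i) ^ 2)%R).

Definition is_diameter_graph (d n : nat) (E : {set {set 'I_n}}) (W : {set 'I_n}) : Prop :=
  exists (f : 'I_n -> point d) (D : R),
    (forall x y, x \in W -> y \in W -> x <> y -> f x <> f y) /\
    (exists x y, x \in W /\ y \in W /\ edist (f x) (f y) = D) /\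
    (forall x y, x \in W -> y \in W -> (edist (f x) (f y) <= D)%R) /\
    (forall x y, x \in W -> y \in W -> x <> y ->
       (adj E x y <-> edist (f x) (f y) = D)).

Definition colorable (n : nat) (E : {set {set 'I_n}}) (W : {set 'I_n}) (k : nat) : Prop :=
  exists c : 'I_n -> nat,
    (forall x, x \in W -> (c x < k)%N) /\
    (forall x y, x \in W -> y \in W -> adj E x y -> c x <> c y).

Definition chromatic_eq (n : nat) (E : {set {set 'I_n}}) (W : {set 'I_n}) (m : nat) : Prop :=
  colorable E W m /\ forall k, (k < m)%N -> ~ colorable E W k.

Definition connected_ind (n : nat) (E : {set {set 'I_n}}) (W : {set 'I_n}) : Prop :=
  forall x y, x \in W -> y \in W ->
    connect (fun a b => [&& a \in W, b \in W & adj E a b]) x y.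

Definition event (d n k : nat) (conn : bool) (E : {set {set 'I_n}}) : Prop :=
  exists W : {set 'I_n}, #|W| = k /\ is_diameter_graph d E W /\
    chromatic_eq E W d.+1 /\ (conn -> connected_ind E W).

Definition weight (n : nat) (p : R) (E : {set {set 'I_n}}) : R :=
  (p ^ #|E| * (1 - p) ^ (#|pairs n| - #|E|))%R.

Definition prob (n : nat) (p : R) (A : {set {set 'I_n}} -> Prop) : R :=
  \big[Rplus/0%R]_(E : {set {set 'I_n}} | E \subset pairs n)
     (weight p E * (if excluded_middle_informative (A E) then 1 else 0))%R.

(* u_d(n,p) = m  (conn = false)   and   u'_d(n,p) = m  (conn = true):
   m is the largest positive k with P(event k) > 1/2, or m = 0 if none. *)
Definition u_eq (conn : bool) (d n : nat) (p : R) (m : nat) : Prop :=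
  (m = 0%N /\ forall k, (0 < k)%N -> ~ (prob p (@event d n k conn) > 1/2)%R) \/
  ((0 < m)%N /\ (prob p (@event d n m conn) > 1/2)%R /\
     forall k, (m < k)%N -> ~ (prob p (@event d n k conn) > 1/2)%R).

(* Main.v *)
(** Let H be the complement of G(n,p), a random graph of edge density q.

    Upper bound: five points of the plane span at most five diameters.  Indeed
    a graph with six edges on five vertices contains a 4-cycle or a butterfly
    (two triangles sharing a vertex), and neither embeds as unit distances in
    a set of diameter 1.  So a diameter graph on at least five vertices yields
    five vertices spanning five edges of H, which has probability
    O((nq)^5) -> 0.

    Lower bound: a triangle o, a, c with an edge from o to a further vertex b is
    a connected diameter graph with chromatic number 3.  It appears as soon as
    o has degree 0 in H (failure probability at most nq), H has no triangle
    (at most (nq)^3), and H contains a path a-b-c.  The last is the second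
    moment method, run on paths whose three vertices lie in three prescribed
    classes of size n/3; this is where q n^(3/2) -> oo is used. *)

From HB Require Import structures.
Require Import Defs.
From mathcomp Require Import all_boot.
From Stdlib Require Import Reals Lra Psatz ClassicalEpsilon FunctionalExtensionality.
Set Implicit Arguments. Unset Strict Implicit. Unset Printing Implicit Defensive.

(** * Real sums, and expectations over the random graph *)

HB.instance Definition _ :=
  Monoid.isComLaw.Build R 0%R Rplus
    (fun x y z => esym (Rplus_assoc x y z)) Rplus_comm Rplus_0_l.
HB.instance Definition _ :=
  Monoid.isComLaw.Build R 1%R Rmult
    (fun x y z => esym (Rmult_assoc x y z)) Rmult_comm Rmult_1_l.
HB.instance Definition _ :=
  Monoid.isMulLaw.Build R 0%R Rmult Rmult_0_l Rmult_0_r.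
HB.instance Definition _ :=
  Monoid.isAddLaw.Build R Rmult Rplus Rmult_plus_distr_r Rmult_plus_distr_l.

Notation "\rsum_ ( i | P ) F" := (\big[Rplus/0%R]_(i | P%B) F%R)
  (at level 41, i at level 60, F at level 41).
Notation "\rsum_ ( i : t | P ) F" := (\big[Rplus/0%R]_(i : t | P%B) F%R)
  (at level 41, i at level 60, F at level 41, only parsing).
Notation "\rsum_ ( i : t ) F" := (\big[Rplus/0%R]_(i : t) F%R)
  (at level 41, i at level 60, F at level 41).

Definition indic (P : Prop) : R :=
  if excluded_middle_informative P then 1%R else 0%R.

(** Up to unfolding, [prob p A] is the expectation of the indicator of [A], so bounds on
    probabilities reduce to pointwise inequalities through [expect_le]. *)
Definition expect (n : nat) (p : R) (X : {set {set 'I_n}} -> R) : R :=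
  \rsum_(E : {set {set 'I_n}} | E \subset pairs n) (weight p E * X E).

Lemma indic_true (P : Prop) : P -> indic P = 1%R.
Proof. by rewrite /indic; case: excluded_middle_informative. Qed.

Lemma indic_false (P : Prop) : ~ P -> indic P = 0%R.
Proof. by rewrite /indic; case: excluded_middle_informative. Qed.

Lemma rsum_le (I : finType) (P : pred I) (F G : I -> R) :
  (forall i, P i -> (F i <= G i)%R) ->
  (\rsum_(i | P i) F i <= \rsum_(i | P i) G i)%R.
Proof.
move=> FG; elim/big_rec2: _ => [|i x y Pi xy]; first exact: Rle_refl.
by apply: Rplus_le_compat => //; apply: FG.
Qed.

Lemma rsum_ge0 (I : finType) (P : pred I) (F : I -> R) :
  (forall i, P i -> (0 <= F i)%R) -> (0 <= \rsum_(i | P i) F i)%R.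
Proof.
move=> F0; apply: big_ind => [|x y|//]; [lra|lra].
Qed.

Lemma rsum_const (I : finType) (A : {pred I}) (c : R) :
  \rsum_(i | i \in A) c = (INR #|A| * c)%R.
Proof.
rewrite big_const; elim: #|A| => [|k IH]; first by rewrite /= Rmult_0_l.
by rewrite iterS IH S_INR; ring.
Qed.

Lemma rprod_const (I : finType) (A : {pred I}) (c : R) :
  \big[Rmult/1%R]_(i in A) c = (c ^ #|A|)%R.
Proof. by rewrite big_const; elim: #|A| => [//|k IH]; rewrite iterS IH. Qed.

(** Independence enters here. The sum over edge sets is the expansion of a product of factors
    [f e + g e], with [f] for the presence and [g] for the absence of [e]. The factor is [1 - p] for
    [e] in [F] and 1 elsewhere; [f] vanishes off [pairs n], which removes the sets [E] that are not
    graphs. *)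
Lemma expect_avoid (n : nat) (p : R) (F : {set {set 'I_n}}) :
  F \subset pairs n ->
  expect p (fun E => indic [disjoint F & E]) = ((1 - p) ^ #|F|)%R.
Proof.
move=> FP.
pose f e := (if (e \in pairs n) && (e \notin F) then p else 0)%R.
pose g e := (if e \in pairs n then 1 - p else 1)%R.
have <- : \big[Rmult/1%R]_e (f e + g e)%R = ((1 - p) ^ #|F|)%R.
  rewrite -rprod_const [RHS]big_mkcond; apply: eq_bigr => e _; rewrite /f /g.
  by have /implyP := subsetP FP e; case: (e \in F); case: (e \in pairs n) => //= _; lra.
rewrite bigA_distr /expect.
rewrite [RHS](bigID (fun E : {set {set 'I_n}} => E \subset pairs n)) /=.
rewrite [X in _ = Rplus _ X]big1 ?Rplus_0_r; last first.
  move=> E /subsetPn[e eE eP]; rewrite (bigD1 e) //= eE /f (negbTE eP) /=.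
  exact: Rmult_0_l.
apply: eq_bigr => E EP.
have [dis|] := boolP [disjoint F & E].
  rewrite indic_true // Rmult_1_r /weight (bigID (mem E)) /=; congr Rmult.
    rewrite -rprod_const; apply: eq_bigr => e eE.
    rewrite eE /f (subsetP EP) //=.
    by rewrite (disjointFl dis).
  have -> : (#|pairs n| - #|E|)%N = #|pairs n :\: E|.
    by rewrite cardsD (setIidPr EP).
  rewrite -rprod_const [RHS]big_mkcond [LHS]big_mkcond; apply: eq_bigr => e _.
  by rewrite !inE /g; case: (e \in E); rewrite //= !inE.
rewrite -setI_eq0 => /set0Pn [e]; rewrite inE => /andP[eF eE].
rewrite indic_false // Rmult_0_r.
by rewrite (bigD1 e) //= eE /f eF andbF Rmult_0_l.
Qed.

Lemma weight_ge0 (n : nat) (p : R) (E : {set {set 'I_n}}) :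
  (0 <= p <= 1)%R -> (0 <= weight p E)%R.
Proof. by move=> ?; apply: Rmult_le_pos; apply: pow_le; lra. Qed.

Lemma expect_le (n : nat) (p : R) (X Y : {set {set 'I_n}} -> R) :
  (0 <= p <= 1)%R ->
  (forall E, (X E <= Y E)%R) -> (expect p X <= expect p Y)%R.
Proof.
move=> p01 XY; apply: rsum_le => E _; apply: Rmult_le_compat_l => //.
exact: weight_ge0.
Qed.

Lemma eq_expect (n : nat) (p : R) (X Y : {set {set 'I_n}} -> R) :
  X =1 Y -> expect p X = expect p Y.
Proof. by move=> XY; apply: eq_bigr => E _; rewrite XY. Qed.

Lemma expectD (n : nat) (p : R) (X Y : {set {set 'I_n}} -> R) :
  expect p (fun E => (X E + Y E)%R) = (expect p X + expect p Y)%R.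
Proof. by rewrite -big_split; apply: eq_bigr => E _ /=; ring. Qed.

Lemma expectZ (n : nat) (p c : R) (X : {set {set 'I_n}} -> R) :
  expect p (fun E => (c * X E)%R) = (c * expect p X)%R.
Proof. by rewrite /expect big_distrr; apply: eq_bigr => E _ /=; ring. Qed.

Lemma expect_sum (n : nat) (p : R) (I : finType) (P : pred I)
    (X : I -> {set {set 'I_n}} -> R) :
  expect p (fun E => \rsum_(i | P i) X i E) = \rsum_(i | P i) expect p (X i).
Proof.
rewrite /expect exchange_big; apply: eq_bigr => E _ /=.
by rewrite big_distrr.
Qed.

Lemma expect_cst (n : nat) (p c : R) :
  expect p (fun _ : {set {set 'I_n}} => c) = c.
Proof.
(* Avoiding the empty set of pairs is certain, so the weights sum to 1. *)
have := expect_avoid p (sub0set (pairs n)); rewrite cards0 /= => H.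
rewrite -[RHS]Rmult_1_r -H -expectZ; apply: eq_expect => E.
by rewrite indic_true ?Rmult_1_r // -setI_eq0 set0I.
Qed.

(** * Plane geometry of sets of diameter 1 *)

Definition sqdist (a b : R * R) : R :=
  ((fst a - fst b) ^ 2 + (snd a - snd b) ^ 2)%R.

(** The condition on two distinct points of a set scaled to diameter 1; squared distances keep it
    polynomial. *)
Definition close_apart (a b : R * R) : Prop := (0 < sqdist a b <= 1)%R.

(** Such a 4-cycle is a rhombus with unit sides: its diagonals satisfy |ac|^2 + |bd|^2 = 4, so one
    of them exceeds 1. The proof works with vectors based at [a]. *)
Lemma unit_diam_no_C4 (a b c d : R * R) :
  close_apart a c -> close_apart b d ->
  sqdist a b = 1%R -> sqdist b c = 1%R -> sqdist c d = 1%R ->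
  sqdist d a = 1%R -> False.
Proof.
unfold close_apart, sqdist.
destruct a as [a1 a2], b as [b1 b2], c as [c1 c2], d as [d1 d2]; simpl fst; simpl snd.
intros [ac0 ac1] [bd0 bd1] ab bc cd da.
pose (u1 := (c1 - a1)%R); pose (u2 := (c2 - a2)%R).
pose (v1 := (b1 - a1)%R); pose (v2 := (b2 - a2)%R).
pose (w1 := (d1 - a1)%R); pose (w2 := (d2 - a2)%R).
pose (U := (u1 ^ 2 + u2 ^ 2)%R).
assert (U01 : (0 < U <= 1)%R) by (unfold U, u1, u2; nra).
assert (v_unit : (v1 ^ 2 + v2 ^ 2 = 1)%R) by (unfold v1, v2; nra).
assert (w_unit : (w1 ^ 2 + w2 ^ 2 = 1)%R) by (unfold w1, w2; nra).
assert (uv : (u1 * v1 + u2 * v2 = U / 2)%R) by (unfold U, u1, u2, v1, v2; nra).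
assert (uw : (u1 * w1 + u2 * w2 = U / 2)%R) by (unfold U, u1, u2, w1, w2; nra).
assert (bd : ((b1 - d1) ^ 2 + (b2 - d2) ^ 2 = (v1 - w1) ^ 2 + (v2 - w2) ^ 2)%R)
  by (unfold v1, v2, w1, w2; ring).
rewrite bd in bd0 bd1; clear bd.
clearbody u1 u2 v1 v2 w1 w2.
pose (k := (u1 * v2 - u2 * v1)%R); pose (l := (u1 * w2 - u2 * w1)%R).
(* Lagrange's identity: [k^2 + (u.v)^2 = |u|^2 |v|^2] *)
assert (k2 : (k ^ 2 = U - U ^ 2 / 4)%R).
{ replace (k ^ 2)%R with (U * (v1 ^ 2 + v2 ^ 2) - (u1 * v1 + u2 * v2) ^ 2)%R
    by (unfold U, k; ring).
  rewrite v_unit uv; field. }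
assert (l2 : (l ^ 2 = U - U ^ 2 / 4)%R).
{ replace (l ^ 2)%R with (U * (w1 ^ 2 + w2 ^ 2) - (u1 * w1 + u2 * w2) ^ 2)%R
    by (unfold U, l; ring).
  rewrite w_unit uw; field. }
(* The inner products of [u] with [v] and [w] agree, so only the cross products [k] and [l] separate
   [v] from [w]. *)
assert (vw : (U * ((v1 - w1) ^ 2 + (v2 - w2) ^ 2) = (k - l) ^ 2)%R).
{ replace (U * ((v1 - w1) ^ 2 + (v2 - w2) ^ 2))%R with
    ((k - l) ^ 2 + (u1 * v1 + u2 * v2 - (u1 * w1 + u2 * w2)) ^ 2)%R
    by (unfold U, k, l; ring).
  rewrite uv uw; ring. }
assert (kl : ((k - l) * (k + l) = 0)%R) by (replace ((k - l) * (k + l))%R with (k ^ 2 - l ^ 2)%R by ring; lra).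
(* Equal cross products give b = d; opposite ones give |bd|^2 = 4 - U, at least 3. *)
destruct (Rmult_integral _ _ kl) as [e | e].
- rewrite e in vw.
  assert (0 < U * ((v1 - w1) ^ 2 + (v2 - w2) ^ 2))%R by (apply Rmult_lt_0_compat; lra).
  lra.
- assert (l = - k)%R as -> by lra.
  assert (U * ((v1 - w1) ^ 2 + (v2 - w2) ^ 2) <= U * 1)%R by (apply Rmult_le_compat_l; lra).
  nra.
Qed.

(* [P] and [Q] are the inner products of [c] with [a + b] and [a - b] *)
Lemma unit_sector (P Q : R) :
  (P ^ 2 / 3 + Q ^ 2 = 1)%R -> (P + Q >= 1)%R -> (P - Q >= 1)%R ->
  (3 / 2 <= P)%R /\ (- (1 / 2) <= Q <= 1 / 2)%R.
Proof.
intros e h1 h2.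
(* Since P is at least 1 + |Q|, the equation [e] forces (2|Q| - 1)(|Q| + 1) <= 0; then P^2 = 3(1 -
   Q^2) is at least 9/4. *)
assert (- (1 / 2) <= Q <= 1 / 2)%R by (split; nra).
split; [nra | assumption].
Qed.

(** Seen from [o], both [c] and [d] are unit vectors within 60 degrees of [a] and of [b], hence on
    the 60 degree arc joining these. Being 60 degrees apart themselves, they must be its endpoints,
    against distinctness. *)
Lemma unit_diam_no_butterfly (o a b c d : R * R) :
  close_apart a c -> close_apart a d -> close_apart b c -> close_apart b d ->
  sqdist o a = 1%R -> sqdist o b = 1%R -> sqdist o c = 1%R ->
  sqdist o d = 1%R -> sqdist a b = 1%R -> sqdist c d = 1%R -> False.
Proof.
unfold close_apart, sqdist.
destruct o as [o1 o2], a as [a1' a2'], b as [b1' b2'], c as [c1' c2'], d as [d1' d2']; simpl fst; simpl snd.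
pose (a1 := (a1' - o1)%R); pose (a2 := (a2' - o2)%R).
pose (b1 := (b1' - o1)%R); pose (b2 := (b2' - o2)%R).
pose (c1 := (c1' - o1)%R); pose (c2 := (c2' - o2)%R).
pose (d1 := (d1' - o1)%R); pose (d2 := (d2' - o2)%R).
intros ac ad bc bd oa ob oc od ab cd.
assert (ea : (a1 * a1 + a2 * a2 = 1)%R) by (unfold a1, a2; lra).
assert (eb : (b1 * b1 + b2 * b2 = 1)%R) by (unfold b1, b2; lra).
assert (ec : (c1 * c1 + c2 * c2 = 1)%R) by (unfold c1, c2; lra).
assert (ed : (d1 * d1 + d2 * d2 = 1)%R) by (unfold d1, d2; lra).
assert (eab : (a1 * b1 + a2 * b2 = 1 / 2)%R) by (unfold a1, a2, b1, b2; lra).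
assert (ecd : (c1 * d1 + c2 * d2 = 1 / 2)%R) by (unfold c1, c2, d1, d2; lra).
assert (iac : (1 / 2 <= a1 * c1 + a2 * c2 < 1)%R) by (unfold a1, a2, c1, c2; lra).
assert (iad : (1 / 2 <= a1 * d1 + a2 * d2 < 1)%R) by (unfold a1, a2, d1, d2; lra).
assert (ibc : (1 / 2 <= b1 * c1 + b2 * c2 < 1)%R) by (unfold b1, b2, c1, c2; lra).
assert (ibd : (1 / 2 <= b1 * d1 + b2 * d2 < 1)%R) by (unfold b1, b2, d1, d2; lra).
clearbody a1 a2 b1 b2 c1 c2 d1 d2.
clear oa ob oc od ab cd ac ad bc bd.
pose (k := (a1 * b2 - a2 * b1)%R).
assert (k2 : (k * k = 3 / 4)%R).
{ replace (k * k)%R with ((a1 * a1 + a2 * a2) * (b1 * b1 + b2 * b2) - (a1 * b1 + a2 * b2) * (a1 * b1 + a2 * b2))%R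
    by (unfold k; ring).
  rewrite ea eb eab; field. }
(* [a + b] and [a - b] are orthogonal of squared norms 3 and 1, so the
   coordinates of a vector on them give its inner products. *)
assert (inner : forall x1 x2 y1 y2 : R,
  (((a1 * x1 + a2 * x2) + (b1 * x1 + b2 * x2)) *
   ((a1 * y1 + a2 * y2) + (b1 * y1 + b2 * y2)) / 3 +
   ((a1 * x1 + a2 * x2) - (b1 * x1 + b2 * x2)) *
   ((a1 * y1 + a2 * y2) - (b1 * y1 + b2 * y2)) = x1 * y1 + x2 * y2)%R).
{ intros x1 x2 y1 y2.
  assert (e : (k * k * (x1 * y1 + x2 * y2) =
    (b1 * b1 + b2 * b2) * ((a1 * x1 + a2 * x2) * (a1 * y1 + a2 * y2)) +
    (a1 * a1 + a2 * a2) * ((b1 * x1 + b2 * x2) * (b1 * y1 + b2 * y2)) -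
    (a1 * b1 + a2 * b2) * ((a1 * x1 + a2 * x2) * (b1 * y1 + b2 * y2) +
       (b1 * x1 + b2 * x2) * (a1 * y1 + a2 * y2)))%R) by (unfold k; ring).
  rewrite k2 ea eb eab in e; lra. }
pose proof (inner c1 c2 c1 c2) as nc.
pose proof (inner d1 d2 d1 d2) as nd.
pose proof (inner c1 c2 d1 d2) as ncd.
rewrite ec in nc; rewrite ed in nd; rewrite ecd in ncd.
set (P := (a1 * c1 + a2 * c2 + (b1 * c1 + b2 * c2))%R) in *.
set (Q := (a1 * c1 + a2 * c2 - (b1 * c1 + b2 * c2))%R) in *.
set (P' := (a1 * d1 + a2 * d2 + (b1 * d1 + b2 * d2))%R) in *.
set (Q' := (a1 * d1 + a2 * d2 - (b1 * d1 + b2 * d2))%R) in *.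
assert (h1 : (1 <= P + Q < 2)%R) by (unfold P, Q; lra).
assert (h2 : (1 <= P - Q < 2)%R) by (unfold P, Q; lra).
assert (h3 : (1 <= P' + Q' < 2)%R) by (unfold P', Q'; lra).
assert (h4 : (1 <= P' - Q' < 2)%R) by (unfold P', Q'; lra).
destruct (@unit_sector P Q) as [p q]; try lra.
destruct (@unit_sector P' Q') as [p' q']; try lra.
clearbody P Q P' Q'.
(* [ncd] says P P'/3 + Q Q' = 1/2, while P P'/3 is at least 3/4 and Q Q' at least -1/4: every bound
   is attained. *)
assert (PP : (P * P' = 9 / 4)%R) by nra.
assert (P32 : P = (3 / 2)%R) by nra.
assert (QQ : (Q * Q = 1 / 4)%R) by nra.
(* The strict bounds in [h1] and [h2] express that [c] differs from [a] and from [b]. *)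
assert (-(1/2) < Q < 1/2)%R by lra.
nra.
Qed.

(** * Edge counting on five vertices by exhaustion *)

Definition K5 : seq (nat * nat) :=
  [seq (i, j) | i <- iota 0 5, j <- iota i.+1 (4 - i)].

Definition sym_mem (s : seq (nat * nat)) (i j : nat) : bool :=
  ((i, j) \in s) || ((j, i) \in s).

(** The vertices run through all orders: either the first four carry the 4-cycle, or the fifth is
    the centre of the butterfly and the first four form its two outer edges. *)
Definition has_C4_or_butterfly (s : seq (nat * nat)) : bool :=
  has (fun v =>
      if v is [:: a; b; c; d; o] then
        [&& sym_mem s a b, sym_mem s b c, sym_mem s c d & sym_mem s d a] ||
        [&& sym_mem s o a, sym_mem s o b, sym_mem s o c, sym_mem s o d,
            sym_mem s a b & sym_mem s c d]
      else false)
    (permutations (iota 0 5)).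

(** An explicit list of masks lets a claim about all subgraphs of [K5] be settled by evaluation. *)
Fixpoint bitseqs (k : nat) : seq bitseq :=
  if k is k'.+1 then [seq b :: m | b <- [:: true; false], m <- bitseqs k']
  else [:: [::]].

Lemma mem_bitseqs (m : bitseq) : m \in bitseqs (size m).
Proof.
elim: m => // b m IH; rewrite [bitseqs _]/=.
by case: b; rewrite !mem_cat map_f ?orbT.
Qed.

Lemma six_edges_on_five_vertices (g : pred (nat * nat)) :
  (5 < count g K5)%N -> has_C4_or_butterfly (filter g K5).
Proof.
have check : all (fun m => (5 < count idfun m)%N ==> has_C4_or_butterfly (mask m K5))
                 (bitseqs 10) by vm_compute.
(* [g] enters only through its mask on [K5], one of the 1024 bit sequences just checked. *)
have := allP check (map g K5) (mem_bitseqs (map g K5)).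
by rewrite filter_mask => /implyP H; rewrite -(count_map g idfun) => /H.
Qed.

Lemma five_points_diameters (x : nat -> R * R) (g : pred (nat * nat)) :
  (forall i j, (i < 5)%N -> (j < 5)%N -> i <> j -> close_apart (x i) (x j)) ->
  (forall i j, (i < 5)%N -> (j < 5)%N -> i <> j -> g (i, j) ->
     sqdist (x i) (x j) = 1%R) ->
  (count g K5 <= 5)%N.
Proof.
move=> close unit; rewrite leqNgt; apply/negP => /six_edges_on_five_vertices.
have sqC p r : sqdist p r = sqdist r p by rewrite /sqdist; ring.
have adj1 i j : sym_mem (filter g K5) i j -> sqdist (x i) (x j) = 1%R.
  have K i' j' : (i', j') \in filter g K5 -> sqdist (x i') (x j') = 1%R.
    rewrite mem_filter => /andP[gij]; rewrite /K5 => /allpairsPdep[k [l [kP lP]]].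
    move=> [e1 e2]; move: gij kP lP; rewrite -{}e1 -{}e2 !mem_iota /= => gij kP /andP[ij j5].
    apply: unit => //; first by rewrite -(subnKC (n := 5) (m := i'.+1)) // addSn addnS.
    by move=> e; rewrite e ltnn in ij.
  by case/orP => /K; rewrite // sqC.
rewrite /has_C4_or_butterfly; move: (filter g K5) adj1 => s adj1.
case/hasP => v; rewrite mem_permutations => pv.
have us : uniq v by rewrite (perm_uniq pv).
have lt5 i : i \in v -> (i < 5)%N by rewrite (perm_mem pv) mem_iota.
case: v us lt5 {pv} => [|a [|b [|c [|d [|o []]]]]] // us lt5.
have cl i j : i \in [:: a; b; c; d; o] -> j \in [:: a; b; c; d; o] -> i != j ->
    close_apart (x i) (x j).
  by move=> iv jv /eqP; apply: close; apply: lt5.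
move: us; rewrite /= !inE !negb_or -!andbA.
case/and5P => ab ac ad ao /and5P[bc bd bo cd /and3P[co d_o _]].
case/orP.
  case/and4P => /adj1 ? /adj1 ? /adj1 ? /adj1 ?.
  by apply: (@unit_diam_no_C4 (x a) (x b) (x c) (x d)) => //; apply: cl;
    rewrite // !inE eqxx ?orbT.
case/and5P => /adj1 ? /adj1 ? /adj1 ? /adj1 ? /andP[/adj1 ? /adj1 ?].
by apply: (@unit_diam_no_butterfly (x o) (x a) (x b) (x c) (x d)) => //; apply: cl;
  rewrite // !inE eqxx ?orbT.
Qed.

(** * From a diameter graph to five points of diameter 1 *)

Lemma sqdist_gt0 (a b : R * R) : a <> b -> (0 < sqdist a b)%R.
Proof.
case: a b => a1 a2 [b1 b2] ab; rewrite /sqdist /=; apply: Rnot_le_lt => le0.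
apply: ab; have sq0 x y : (x ^ 2 + y ^ 2 <= 0 -> x = 0)%R by move=> ?; nra.
have /Rminus_diag_uniq -> : (a1 - b1 = 0)%R by apply: sq0 le0.
by have /Rminus_diag_uniq -> : (a2 - b2 = 0)%R by apply: (sq0 _ (a1 - b1)%R); lra.
Qed.

Lemma edist2 (a b : point 2) :
  edist a b = sqrt (sqdist (a ord0, a ord_max) (b ord0, b ord_max)).
Proof.
rewrite /edist /sqdist !big_ord_recl big_ord0 /= Rplus_0_r.
by congr (sqrt ((_ + (a _ - b _) ^ 2)%R)); apply: val_inj.
Qed.

Lemma diameter_graph_five (n : nat) (E : {set {set 'I_n}}) (W : {set 'I_n})
    (v : nat -> 'I_n) :
  is_diameter_graph 2 E W -> (forall i, (i < 5)%N -> v i \in W) ->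
  (forall i j, (i < 5)%N -> (j < 5)%N -> v i = v j -> i = j) ->
  (count (fun ij => adj E (v ij.1) (v ij.2)) K5 <= 5)%N.
Proof.
move=> [f [D [finj [_ [fD fadj]]]]] vW vinj.
(* [x] is the configuration rescaled to diameter 1, [y] the original one. *)
pose x i : R * R := (f (v i) ord0 / D, f (v i) ord_max / D)%R.
pose y i : R * R := (f (v i) ord0, f (v i) ord_max)%R.
have y0 i j : (i < 5)%N -> (j < 5)%N -> i <> j -> (0 < sqdist (y i) (y j))%R.
  move=> i5 j5 ij; apply: sqdist_gt0 => -[e0 e1].
  apply: (finj (v i) (v j)); rewrite ?vW //; first by move/(vinj i j i5 j5).
  apply: functional_extensionality => k.
  by case: k => [[|[|k]] // k2]; [move: e0|move: e1];
    congr (_ = _); congr (f _ _); apply: val_inj.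
(* [v 0] and [v 1] have distinct images, so division by [D] is legitimate. *)
have D0 : (0 < D)%R.
  have := fD (v 0) (v 1) (vW 0 isT) (vW 1 isT); rewrite edist2.
  by apply: Rlt_le_trans; apply: sqrt_lt_R0; apply: (y0 0 1).
have sx i j : sqdist (x i) (x j) = (sqdist (y i) (y j) / (D * D))%R.
  by rewrite /sqdist /x /y /=; field; lra.
have DD : (0 < D * D)%R by nra.
apply: (@five_points_diameters x) => i j i5 j5 ij.
  rewrite /close_apart sx; split.
    by apply: Rdiv_lt_0_compat => //; apply: y0.
  have := fD (v i) (v j) (vW i i5) (vW j j5); rewrite edist2 => le.
  apply: (Rmult_le_reg_r (D * D)) => //.
  rewrite /Rdiv Rmult_assoc Rinv_l; last lra.
  rewrite Rmult_1_r Rmult_1_l -(sqrt_sqrt (sqdist _ _)); last exact/Rlt_le/y0.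
  by have := sqrt_pos (sqdist (y i) (y j)); rewrite /y; nra.
have vij : v i <> v j by move/(vinj i j i5 j5).
case: (fadj (v i) (v j) (vW i i5) (vW j j5) vij) => /= H _ /H.
rewrite edist2 sx -/(y i) -/(y j) => e.
have {1}-> : sqdist (y i) (y j) = (D * D)%R.
  by rewrite -e sqrt_sqrt //; apply/Rlt_le/y0.
by field; lra.
Qed.

(** * The triangle with a pendant edge *)

Lemma adjC (n : nat) (E : {set {set 'I_n}}) (x y : 'I_n) : adj E x y = adj E y x.
Proof. by rewrite /adj eq_sym setUC. Qed.

Lemma adjxx (n : nat) (E : {set {set 'I_n}}) (x : 'I_n) : adj E x x = false.
Proof. by rewrite /adj eqxx. Qed.

Lemma sqrt_eq1 (x : R) : sqrt x = 1%R <-> x = 1%R.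
Proof.
split=> [e|->]; last exact: sqrt_1.
have x0 : (0 < x)%R.
  by apply: Rnot_le_lt => x0; move: e; rewrite sqrt_neg_0 //; lra.
by rewrite -(sqrt_sqrt x) ?e; lra.
Qed.

Lemma sqrt_le1 (x : R) : (x <= 1)%R -> (sqrt x <= 1)%R.
Proof. by move=> x1; rewrite -sqrt_1; apply: sqrt_le_1_alt. Qed.

(* The diameter is 1: [o], [a], [c] form a unit equilateral triangle and [b]
   lies on the unit circle around [o], strictly between [a] and [c]. *)
Lemma triangle_pendant_diameter_graph (n : nat) (E : {set {set 'I_n}})
    (o a b c : 'I_n) :
  uniq [:: o; a; b; c] ->
  adj E o a -> adj E o b -> adj E o c -> adj E a c ->
  ~~ adj E a b -> ~~ adj E b c ->
  is_diameter_graph 2 E [set:: [:: o; a; b; c]].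
Proof.
rewrite /= !inE !negb_or -!andbA.
case/and5P=> oa ob oc ab /and3P[ac bc _] Eoa Eob Eoc Eac Eab Ebc.
(* The 3-4-5 triangle supplies a rational unit vector for [b], at about 37 degrees, while [a] and
   [c] lie at 0 and 60 degrees. *)
pose pt v : R * R :=
  if v == o then (0, 0)%R else if v == a then (1, 0)%R else
  if v == c then (1 / 2, sqrt 3 / 2)%R else (4 / 5, 3 / 5)%R.
pose f v : point 2 := fun i => if i == ord0 then (pt v).1 else (pt v).2.
have fE x y : edist (f x) (f y) = sqrt (sqdist (pt x) (pt y)).
  by rewrite edist2; congr sqrt; case: (pt x) (pt y) => ? ? [].
have po : pt o = (0, 0)%R by rewrite /pt eqxx.
have pa : pt a = (1, 0)%R by rewrite /pt eq_sym (negbTE oa) eqxx.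
have pc : pt c = (1 / 2, sqrt 3 / 2)%R.
  by rewrite /pt eq_sym (negbTE oc) eq_sym (negbTE ac) eqxx.
have pb : pt b = (4 / 5, 3 / 5)%R.
  by rewrite /pt eq_sym (negbTE ob) eq_sym (negbTE ab) (negbTE bc).
have s3 : (sqrt 3 * sqrt 3 = 3)%R by apply: sqrt_sqrt; lra.
(* These bounds place the squared distance 6/5 - (3/5) sqrt 3 between [b] and [c] strictly between 0
   and 1. *)
have s3_gt : (17 / 10 < sqrt 3)%R by have := sqrt_pos 3; nra.
have s3_lt : (sqrt 3 < 18 / 10)%R by nra.
have sqC p r : sqdist p r = sqdist r p by rewrite /sqdist; ring.
have doa : sqdist (pt o) (pt a) = 1%R by rewrite po pa /sqdist /=; lra.
have dob : sqdist (pt o) (pt b) = 1%R by rewrite po pb /sqdist /=; lra.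
have doc : sqdist (pt o) (pt c) = 1%R by rewrite po pc /sqdist /=; nra.
have dac : sqdist (pt a) (pt c) = 1%R by rewrite pa pc /sqdist /=; nra.
have dab : (0 < sqdist (pt a) (pt b) < 1)%R by rewrite pa pb /sqdist /=; lra.
have dbc : (0 < sqdist (pt b) (pt c) < 1)%R by rewrite pb pc /sqdist /=; nra.
have dxx x : sqdist (pt x) (pt x) = 0%R by rewrite /sqdist; ring.
have key x y : x \in [:: o; a; b; c] -> y \in [:: o; a; b; c] ->
    [\/ x = y, adj E x y /\ sqdist (pt x) (pt y) = 1%R
      | ~~ adj E x y /\ (0 < sqdist (pt x) (pt y) < 1)%R].
  rewrite !inE => /or4P[] /eqP-> /or4P[] /eqP->; 
    first [by apply: Or31 | by apply: Or32 | by apply: Or33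
          | by apply: Or32; rewrite adjC sqC | by apply: Or33; rewrite adjC sqC].
exists f, 1%R; split=> [x y xW yW xy fxy|].
  have := dxx x; rewrite !inE in xW yW.
  have e : sqrt (sqdist (pt x) (pt y)) = 0%R.
    by rewrite -fE fxy fE dxx sqrt_0.
  have := key x y; rewrite !inE => /(_ xW yW) [//|[_ d1]|[_ [d0 _]]].
    by rewrite d1 sqrt_1 in e; lra.
  by have := sqrt_lt_R0 _ d0; lra.
split; first by exists o, a; rewrite !inE !eqxx orbT fE doa sqrt_1.
split=> x y xW yW; last move=> xy; rewrite !fE.
  apply: sqrt_le1; rewrite !inE in xW yW.
  have := key x y; rewrite !inE => /(_ xW yW) [->|[_ ->]|[_ ?]]; rewrite ?dxx; lra.
rewrite !inE in xW yW; rewrite sqrt_eq1.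
have := key x y; rewrite !inE => /(_ xW yW) [//|[-> ->]//|[/negbTE-> ?]].
by split=> // ?; lra.
Qed.

Lemma triangle_pendant_event (n : nat) (E : {set {set 'I_n}}) (conn : bool)
    (o a b c : 'I_n) :
  uniq [:: o; a; b; c] ->
  adj E o a -> adj E o b -> adj E o c -> adj E a c ->
  ~~ adj E a b -> ~~ adj E b c ->
  event 2 4 conn E.
Proof.
move=> us Eoa Eob Eoc Eac Eab Ebc.
set W : {set 'I_n} := [set:: [:: o; a; b; c]].
have inW x : x \in W = [|| x == o, x == a, x == b | x == c] by rewrite !inE.
exists W; split; first by rewrite cardsE (card_uniqP us).
split; first exact: triangle_pendant_diameter_graph.
have oW : o \in W by rewrite inW eqxx.
have aW : a \in W by rewrite inW eqxx !orbT.
have cW : c \in W by rewrite inW eqxx !orbT.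
have Ebx x : x \in W -> adj E b x -> x = o.
  by rewrite inW => /or4P[] /eqP->; rewrite ?adjxx ?(negbTE Ebc) // adjC (negbTE Eab).
have adjoW x : x \in W -> x = o \/ adj E o x.
  by rewrite inW => /or4P[] /eqP->; [left|right|right|right].
have ob : (o == b) = false.
  by apply/negbTE; apply: contraTneq Eob => <-; rewrite adjxx.
have oa : (a == o) = false.
  by apply/negbTE; apply: contraTneq Eoa => ->; rewrite adjxx.
have oc : (c == o) = false.
  by apply/negbTE; apply: contraTneq Eoc => ->; rewrite adjxx.
have ac : (c == a) = false.
  by apply/negbTE; apply: contraTneq Eac => ->; rewrite adjxx.
have bc : (c == b) = false.
  by apply/negbTE; move: us; rewrite /= !inE [b == c]eq_sym => /and4P[_ _].
split.
  split.
    (* The non-adjacent vertices [a] and [b] share colour 1; the triangle [o], [a], [c] later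
       excludes two colours. *)
    exists (fun x => if x == o then 0 else if x == c then 2 else 1)%N; split.
      by move=> x _; case: ifP => // _; case: ifP.
    move=> x y; rewrite !inW => /or4P[] /eqP-> /or4P[] /eqP->;
      rewrite ?eqxx ?adjxx ?oa ?oc ?[b == o]eq_sym ?ob ?[a == c]eq_sym ?ac
        ?[b == c]eq_sym ?bc //.
      by rewrite (negbTE Eab).
    by rewrite adjC (negbTE Eab).
  move=> k k3 [col [colk colE]].
  have := colk o oW; have := colk a aW; have := colk c cW.
  have := colE o a oW aW Eoa; have := colE o c oW cW Eoc; have := colE a c aW cW Eac.
  by case: k k3 {colk} => [|[|[|]]] // _;
    case: (col o) => [|[|]] //; case: (col a) => [|[|]] //; case: (col c) => [|[|]].
move=> _ x y xW yW.
(* [o] is adjacent to the other three vertices, so every connection goes through it. *)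
apply: (@connect_trans _ _ o).
  case: (adjoW x xW) => [->|Eox]; first exact: connect0.
  by apply: connect1; rewrite xW oW adjC.
case: (adjoW y yW) => [->|Eoy]; first exact: connect0.
by apply: connect1; rewrite oW yW.
Qed.

(** * Union bound, and the upper bound for five or more vertices *)

Lemma set2_inj (T : finType) (a b c d : T) :
  [set a; b] = [set c; d] -> (a = c /\ b = d) \/ (a = d /\ b = c).
Proof.
move=> e.
have : c \in [set a; b] by rewrite e set21.
have : d \in [set a; b] by rewrite e set22.
have : b \in [set c; d] by rewrite -e set22.
have : a \in [set c; d] by rewrite -e set21.
by rewrite !inE => /orP[]/eqP-> /orP[]/eqP->; rewrite ?eqxx ?orbb ?orbT;
  [move=> /eqP-> | auto | auto | move=> _ /eqP->]; auto.
Qed.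

Lemma pow_le_pow (q : R) (j k : nat) :
  (0 <= q <= 1)%R -> (j <= k)%N -> (q ^ k <= q ^ j)%R.
Proof.
move=> q01 /subnKC <-; rewrite pow_add.
have qj : (0 <= q ^ j)%R by apply: pow_le; lra.
have : (q ^ (k - j) <= 1)%R by rewrite -(pow1 (k - j)); apply: pow_incr.
by nra.
Qed.

Lemma rsum_ge_term (I : finType) (F : I -> R) (i : I) :
  (forall j, (0 <= F j)%R) -> (F i <= \rsum_(j : I) F j)%R.
Proof.
move=> F0; rewrite (bigD1 i) //=.
have : (0 <= \rsum_(j | j != i) F j)%R by apply: rsum_ge0.
lra.
Qed.

Lemma indic_ge0 (P : Prop) : (0 <= indic P)%R.
Proof. by rewrite /indic; case: excluded_middle_informative => ? /=; lra. Qed.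

Lemma indic_le1 (P : Prop) : (indic P <= 1)%R.
Proof. by rewrite /indic; case: excluded_middle_informative => ? /=; lra. Qed.

(** First moment bound: missing all of a fixed [F i] has probability at most q^k. The predicate [P]
    discards degenerate indices, such as tuples with repetitions, while the count over all of [I]
    stays a closed formula. *)
Lemma union_bound (n : nat) (p : R) (A : {set {set 'I_n}} -> Prop)
    (I : finType) (P : pred I) (F : I -> {set {set 'I_n}}) (k : nat) :
  (0 <= p <= 1)%R ->
  (forall E, A E -> exists2 i, P i & [disjoint F i & E]) ->
  (forall i, P i -> F i \subset pairs n) ->
  (forall i, P i -> (k <= #|F i|)%N) ->
  (prob p A <= INR #|I| * (1 - p) ^ k)%R.
Proof.
move=> p01 AF FP Fk.
pose X i (E : {set {set 'I_n}}) := if P i then indic [disjoint F i & E] else 0%R.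
have X0 i E : (0 <= X i E)%R.
  by rewrite /X; case: ifP => _; [exact: indic_ge0 | lra].
apply: (Rle_trans _ (expect p (fun E => \rsum_(i : I) X i E))).
  apply: expect_le => // E; rewrite -/(indic _).
  have [|nA] := excluded_middle_informative (A E); last first.
    by rewrite indic_false //; apply: rsum_ge0.
  move=> AE; have [i Pi dis] := AF E AE.
  apply: Rle_trans (rsum_ge_term i (fun j => X0 j E)).
  by rewrite /X Pi (indic_true dis); apply: indic_le1.
have <- : \rsum_(i : I) ((1 - p) ^ k) = (INR #|I| * (1 - p) ^ k)%R.
  by rewrite -rsum_const; apply: eq_bigl.
rewrite (expect_sum p xpredT X); apply: rsum_le => i _; rewrite /X.
case Pi: (P i); last first.
  by rewrite expect_cst; apply: pow_le; lra.
rewrite expect_avoid ?FP //; apply: pow_le_pow; [lra | exact: Fk].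
Qed.

Definition edges_of (n : nat) (v : nat -> 'I_n) (s : seq (nat * nat)) :
    {set {set 'I_n}} :=
  [set:: [seq [set v ij.1; v ij.2] | ij <- s]].

Lemma K5_lt (ij : nat * nat) : ij \in K5 -> (ij.1 < ij.2 < 5)%N.
Proof. by move: ij; apply/allP. Qed.

Lemma edges_of_subset (n : nat) (v : nat -> 'I_n) (s : seq (nat * nat)) :
  {in [pred i | (i < 5)%N] &, injective v} -> {subset s <= K5} ->
  edges_of v s \subset pairs n.
Proof.
move=> vinj sK; apply/subsetP => e; rewrite inE => /mapP[[i j] /sK/K5_lt /=].
move=> /andP[ij j5] ->; rewrite inE cards2 eqSS eqb1; apply/eqP => /vinj e'; move: (ij).
by rewrite e' ?inE ?ltnn // (ltn_trans ij j5).
Qed.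

Lemma card_edges_of (n : nat) (v : nat -> 'I_n) (s : seq (nat * nat)) :
  {in [pred i | (i < 5)%N] &, injective v} -> {subset s <= K5} -> uniq s ->
  #|edges_of v s| = size s.
Proof.
move=> vinj sK us; rewrite cardsE (card_uniqP _) ?size_map //.
rewrite map_inj_in_uniq // => -[i j] [k l] /sK/K5_lt/andP[/= ij j5].
move=> /sK/K5_lt/andP[/= kl l5] e.
have i5 := ltn_trans ij j5; have k5 := ltn_trans kl l5.
have [[/vinj -> // /vinj -> //]|[/vinj il /vinj jk]] := set2_inj e.
by move: ij; rewrite il // jk // ltnNge ltnW.
Qed.

(** Any five vertices of the diameter graph span at least five non-edges. A 5-tuple of vertices and
    a mask on the ten pairs select them: n^5 times 2^10 = 1024 choices, each of probability at most
    q^5. *)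
Lemma prob_event_large (n k : nat) (p : R) (conn : bool) :
  (0 <= p <= 1)%R -> (5 <= k)%N ->
  (prob p (@event 2 n k conn) <= 1024 * (INR n * (1 - p)) ^ 5)%R.
Proof.
move=> p01 k5.
(* [inord] makes the labelling total on [nat]; only indices below 5 matter. *)
pose v (t : 5.-tuple 'I_n) i := tnth t (inord i).
pose F (x : 5.-tuple 'I_n * 10.-tuple bool) := edges_of (v x.1) (mask x.2 K5).
pose P (x : 5.-tuple 'I_n * 10.-tuple bool) :=
  uniq x.1 && (5 <= count idfun x.2)%N.
have vinj (t : 5.-tuple 'I_n) : uniq t -> {in [pred i | (i < 5)%N] &, injective (v t)}.
  move=> /tuple_uniqP ut i j; rewrite !inE => i5 j5 /ut e.
  by rewrite -(inordK i5) e inordK.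
have card_I : (INR #|{: 5.-tuple 'I_n * 10.-tuple bool}| = 1024 * INR n ^ 5)%R.
  rewrite card_prod !card_tuple card_bool card_ord mult_INR Rmult_comm.
  congr (_ * _)%R; first by rewrite -(INR_IZR_INZ 1024).
  by rewrite !expnS expn0 !mult_INR /=.
rewrite Rpow_mult_distr -Rmult_assoc -card_I.
have mK (m : bitseq) : {subset mask m K5 <= K5} by move=> ij; apply: mem_mask.
apply: (@union_bound _ _ _ _ P F) => //; last 2 first.
- by case=> t m /andP[/= ut _]; apply: edges_of_subset; [exact: vinj | exact: mK].
- case=> t m /andP[/= ut cm]; rewrite /F card_edges_of ?mask_uniq //.
  + by rewrite size_mask ?size_tuple.
  + exact: vinj.
move=> E [W [cW [diam _]]].
have sW : (5 <= size (enum W))%N by rewrite -cardE cW.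
have size5 : size (take 5 (enum W)) == 5 by rewrite size_takel.
pose t := Tuple size5.
have ut : uniq t by rewrite take_uniq ?enum_uniq.
have tW i : v t i \in W.
  by rewrite -mem_enum; apply: (@mem_take 5); apply: mem_tnth.
pose g (ij : nat * nat) := adj E (v t ij.1) (v t ij.2).
have few : (count g K5 <= 5)%N.
  apply: (diameter_graph_five diam) => [i _|i j i5 j5]; first exact: tW.
  by apply: vinj.
(* The mask selects the non-edges: at most five of the ten pairs are edges, so at least five bits
   are set. *)
have size10 : size (map (predC g) K5) == 10 by rewrite size_map.
exists (t, Tuple size10).
  rewrite /P ut count_map /=; move: (count_predC g K5) few.
  by rewrite -[size K5]/10 => + few; move=> e; rewrite -(leq_add2l (count g K5)) e
    -[10]/(5 + 5)%N leq_add2r.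
have -> : F (t, Tuple size10) = edges_of (v t) (filter (predC g) K5).
  by rewrite filter_mask.
rewrite disjoint_subset; apply/subsetP => e; rewrite !inE.
case/mapP => -[i j]; rewrite mem_filter => /andP[/= nadj /K5_lt/andP[/= ij j5]] ->.
apply: contra nadj => eE; rewrite /g /adj eE andbT.
apply/eqP => /(vinj t ut) /= e'; move: (ij).
by rewrite e' ?inE ?ltnn // (ltn_trans ij j5).
Qed.

(** * Second moment method for paths in the complement *)

Lemma indic_setU (n : nat) (F G E : {set {set 'I_n}}) :
  (indic [disjoint F & E] * indic [disjoint G & E])%R =
  indic [disjoint F :|: G & E].
Proof.
rewrite -!setI_eq0 setIUl setU_eq0.
by case: eqP => _; case: eqP => _; rewrite ?(indic_true isT) /= ?[indic false]indic_false //; lra.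
Qed.

(** Chebyshev's inequality without division, for the number [X] of sets [F i] that are entirely
    absent: where X = 0, mu^2 equals (X - mu)^2, and the expectation of (X - mu)^2 is the variance
    on the right. *)
Lemma second_moment (n : nat) (p : R) (I : finType) (F : I -> {set {set 'I_n}}) :
  (0 <= p <= 1)%R -> (forall i, F i \subset pairs n) ->
  (prob p (fun E => forall i, ~~ [disjoint F i & E]) *
     (\rsum_(i : I) ((1 - p) ^ #|F i|)) ^ 2 <=
   \rsum_(i : I) (\rsum_(j : I) ((1 - p) ^ #|F i :|: F j|)) -
     (\rsum_(i : I) ((1 - p) ^ #|F i|)) ^ 2)%R.
Proof.
move=> p01 FP.
set mu := \rsum_(i : I) _.
pose X (E : {set {set 'I_n}}) := \rsum_(i : I) (indic [disjoint F i & E]).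
have EX : expect p X = mu.
  rewrite (expect_sum p xpredT (fun i E => indic [disjoint F i & E])).
  by apply: eq_bigr => i _; apply: expect_avoid.
have EX2 : expect p (fun E => (X E * X E)%R) =
    \rsum_(i : I) (\rsum_(j : I) ((1 - p) ^ #|F i :|: F j|)).
  transitivity (expect p (fun E => \rsum_(i : I)
      (\rsum_(j : I) (indic [disjoint F i :|: F j & E])))).
    apply: eq_expect => E; rewrite /X big_distrl; apply: eq_bigr => i _ /=.
    by rewrite big_distrr; apply: eq_bigr => j _ /=; apply: indic_setU.
  rewrite (expect_sum p xpredT
    (fun i E => \rsum_(j : I) (indic [disjoint F i :|: F j & E]))).
  apply: eq_bigr => i _.
  rewrite (expect_sum p xpredT (fun j E => indic [disjoint F i :|: F j & E])).
  by apply: eq_bigr => j _; apply: expect_avoid; rewrite subUset !FP.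
have -> : (\rsum_(i : I) (\rsum_(j : I) ((1 - p) ^ #|F i :|: F j|)) - mu ^ 2)%R =
    expect p (fun E => (X E * X E + ((- 2 * mu) * X E + mu ^ 2))%R).
  by rewrite !expectD expectZ expect_cst EX EX2; ring.
rewrite Rmult_comm -expectZ; apply: expect_le => // E; rewrite -/(indic _).
have [all0|some] := excluded_middle_informative (forall i, ~~ [disjoint F i & E]).
  rewrite indic_true // [X E]big1; first lra.
  by move=> i _; rewrite indic_false //; apply/negP.
by rewrite indic_false //; have := pow2_ge_0 (X E - mu); nra.
Qed.

Definition cherry (T : finType) (a b c : T) : {set {set T}} :=
  [set [set a; b]; [set b; c]].

Lemma cherry_subset (n : nat) (a b c : 'I_n) :
  a != b -> b != c -> cherry a b c \subset pairs n.
Proof.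
by move=> ab bc; apply/subsetP => e; rewrite !inE => /orP[] /eqP->;
  rewrite cards2 ?ab ?bc.
Qed.

Lemma rsum_if_le (I : finType) (P : pred I) (k : nat) (c : R) :
  (0 <= c)%R -> (#|P| <= k)%N ->
  (\rsum_(i : I) (if P i then c else 0) <= INR k * c)%R.
Proof.
move=> c0 Pk; rewrite -big_mkcond (rsum_const P).
by apply: Rmult_le_compat_r => //; apply/le_INR/leP.
Qed.

Lemma card_le_range (T : finType) (P : pred T) (m : nat) (f : 'I_m -> T) :
  (forall t, P t -> exists i, t = f i) -> (#|P| <= m)%N.
Proof.
move=> Pf; rewrite -[leqRHS]card_ord; apply: leq_trans (leq_imset_card f predT).
apply: subset_leq_card; apply/subsetP => t /Pf[i ->].
by apply/imsetP; exists i.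
Qed.

(** The vertices come from three consecutive blocks of length [m], with the centre in the middle
    one. They are thus automatically distinct, and two cherries share an edge only where their
    indices agree. *)
Definition tripartite_cherry (m n : nat) (t : 'I_m * 'I_m * 'I_m) :
    {set {set 'I_n.+1}} :=
  cherry (inord t.1.1) (inord (m + t.1.2)) (inord (m + m + t.2)).

Lemma tripartite_vertices_neq (m n : nat) (a b c : 'I_m) :
  (m + m + m <= n.+1)%N ->
  [/\ inord a != inord (m + b) :> 'I_n.+1,
      inord (m + b) != inord (m + m + c) :> 'I_n.+1 &
      inord a != inord (m + m + c) :> 'I_n.+1].
Proof.
move=> mn; have := ltn_ord a; have := ltn_ord b; have := ltn_ord c => cm bm am.
have cn : (m + m + c < n.+1)%N by apply: leq_trans mn; rewrite ltn_add2l.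
have bn : (m + b < n.+1)%N.
  by apply: leq_trans mn; rewrite -addnA ltn_add2l ltn_addr.
have an : (a < n.+1)%N by apply: leq_trans mn; rewrite -addnA ltn_addr.
by rewrite -!val_eqE /= !inordK // -addnA eqn_add2l; split; rewrite ltn_eqF // ltn_addr.
Qed.

(** An edge between the first two blocks never equals one between the last two, so the union has 4
    edges, minus one for each common edge. A sum of indicator terms replaces the case distinction so
    that it can be summed over [t] term by term. *)
Lemma tripartite_overlap (m n : nat) (q : R) (s t : 'I_m * 'I_m * 'I_m) :
  (0 <= q <= 1)%R -> (m + m + m <= n.+1)%N ->
  (q ^ #|tripartite_cherry n s :|: tripartite_cherry n t| <=
   q ^ 4 + ((if s.1 == t.1 then q ^ 3 else 0) +
   ((if (s.1.2 == t.1.2) && (s.2 == t.2) then q ^ 3 else 0) +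
    (if s == t then q ^ 2 else 0))))%R.
Proof.
move=> q01 mn; case: s t => [[a b] c] [[a' b'] c']; cbn [fst snd].
set U := _ :|: _.
have q2 : (0 <= q ^ 2)%R by apply: pow_le; lra.
have q3 : (0 <= q ^ 3)%R by apply: pow_le; lra.
have q4 : (0 <= q ^ 4)%R by apply: pow_le; lra.
have pos (x : bool) y : (0 <= y -> 0 <= if x then y else 0)%R by case: x => //; lra.
have := pos ((a, b) == (a', b')) _ q3.
have := pos ((b == b') && (c == c')) _ q3.
have := pos ((a, b, c) == (a', b', c')) _ q2.
have cardU k (r : seq {set 'I_n.+1}) :
    uniq r -> {subset r <= U} -> size r = k -> (q ^ #|U| <= q ^ k)%R.
  move=> ur rU <-; apply: pow_le_pow => //.
  by rewrite -(card_uniqP ur); apply: subset_leq_card; apply/subsetP.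
pose e x y : {set 'I_n.+1} := [set inord x; inord (m + y)].
pose e' y z : {set 'I_n.+1} := [set inord (m + y); inord (m + m + z)].
have lt1 (x : 'I_m) : (x < n.+1)%N.
  by apply: leq_trans mn; rewrite -addnA ltn_addr.
have lt2 (x : 'I_m) : (m + x < n.+1)%N.
  by apply: leq_trans mn; rewrite -addnA ltn_add2l ltn_addr.
have lt3 (x : 'I_m) : (m + m + x < n.+1)%N.
  by apply: leq_trans mn; rewrite ltn_add2l.
have inj1 (x y : 'I_m) : inord x = inord y :> 'I_n.+1 -> x = y.
  by move/(congr1 val); rewrite /= !inordK // => /val_inj.
have inj2 (x y : 'I_m) : inord (m + x) = inord (m + y) :> 'I_n.+1 -> x = y.
  by move/(congr1 val); rewrite /= !inordK // => /addnI/val_inj.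
have inj3 (x y : 'I_m) : inord (m + m + x) = inord (m + m + y) :> 'I_n.+1 -> x = y.
  by move/(congr1 val); rewrite /= !inordK // => /addnI/val_inj.
have n12 (x y : 'I_m) : inord x <> inord (m + y) :> 'I_n.+1.
  by apply/eqP; case: (tripartite_vertices_neq x y y mn).
have n23 (x y : 'I_m) : inord (m + x) <> inord (m + m + y) :> 'I_n.+1.
  by apply/eqP; case: (tripartite_vertices_neq x x y mn).
have n13 (x y : 'I_m) : inord x <> inord (m + m + y) :> 'I_n.+1.
  by apply/eqP; case: (tripartite_vertices_neq x y y mn).
have einj (x y x' y' : 'I_m) : (e x y == e x' y') = ((x, y) == (x', y')).
  apply/eqP/eqP => [/set2_inj[] []|[-> ->]//]; last by move=> /n12.
  by move=> /inj1-> /inj2->.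
have e'inj (x y x' y' : 'I_m) : (e' x y == e' x' y') = ((x, y) == (x', y')).
  apply/eqP/eqP => [/set2_inj[] []|[-> ->]//]; last by move=> /n23.
  by move=> /inj2-> /inj3->.
have ee' (x y z w : 'I_m) : (e x y == e' z w) = false.
  by apply/eqP => /set2_inj[] []; [move=> /n12 | move=> /n13].
have mem1 : e a b \in U by rewrite /U !inE eqxx.
have mem2 : e' b c \in U by rewrite /U !inE eqxx orbT.
have mem3 : e a' b' \in U by rewrite /U !inE eqxx !orbT.
have mem4 : e' b' c' \in U by rewrite /U !inE eqxx !orbT.
clearbody U.
have [st|st] := eqVneq (a, b, c) (a', b', c') => ? ? ?.
  have H : (q ^ #|U| <= q ^ 2)%R.
    apply: (@cardU 2 [:: e a b; e' b c]) => //; first by rewrite /= !inE ee'.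
    by move=> x; rewrite !inE => /orP[] /eqP->.
  lra.
have [ab|ab] := eqVneq (a, b) (a', b').
  have bc : (b, c) != (b', c').
    by move: ab st => [-> ->]; rewrite !xpair_eqE !eqxx.
  have H : (q ^ #|U| <= q ^ 3)%R.
    apply: (@cardU 3 [:: e a b; e' b c; e' b' c']) => //.
      by rewrite /= !inE !ee' e'inj bc.
    by move=> x; rewrite !inE => /or3P[] /eqP->.
  lra.
have [bc|bc] := boolP ((b == b') && (c == c')).
  have H : (q ^ #|U| <= q ^ 3)%R.
    apply: (@cardU 3 [:: e a b; e a' b'; e' b c]) => //.
      by rewrite /= !inE !ee' einj (negbTE ab).
    by move=> x; rewrite !inE => /or3P[] /eqP->.
  lra.
have H : (q ^ #|U| <= q ^ 4)%R.
  apply: (@cardU 4 [:: e a b; e a' b'; e' b c; e' b' c']) => //.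
    by rewrite /= !inE !ee' einj e'inj (negbTE ab) xpair_eqE (negbTE bc).
  by move=> x; rewrite !inE => /or4P[] /eqP->.
lra.
Qed.

(** The mean is m^3 q^2. Pairs of cherries counted as edge-disjoint contribute m^6 q^4, which
    cancels the squared mean; only the overlapping pairs remain on the right. *)
Lemma prob_no_cherry (m n : nat) (p : R) :
  (0 <= p <= 1)%R -> (m + m + m <= n.+1)%N ->
  (prob p (fun E => forall t : 'I_m * 'I_m * 'I_m,
              ~~ [disjoint tripartite_cherry n t & E]) *
     (INR m ^ 3 * (1 - p) ^ 2) ^ 2 <=
   INR m ^ 3 * (2 * INR m * (1 - p) ^ 3 + (1 - p) ^ 2))%R.
Proof.
move=> p01 mn; set q := (1 - p)%R.
have q01 : (0 <= q <= 1)%R by rewrite /q; lra.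
have card_tri : INR #|{: 'I_m * 'I_m * 'I_m}| = (INR m ^ 3)%R.
  by rewrite !card_prod !card_ord !mult_INR /=; ring.
have sum_cst (x : R) : \rsum_(t : 'I_m * 'I_m * 'I_m) x = (INR m ^ 3 * x)%R.
  by rewrite -card_tri -rsum_const; apply: eq_bigl.
have sub (t : 'I_m * 'I_m * 'I_m) : tripartite_cherry n t \subset pairs n.+1.
  by case: (tripartite_vertices_neq t.1.1 t.1.2 t.2 mn) => ? ? _; apply: cherry_subset.
have card2 (t : 'I_m * 'I_m * 'I_m) : #|tripartite_cherry n t| = 2.
  rewrite cards2; case: eqP => // /set2_inj.
  case: (tripartite_vertices_neq t.1.1 t.1.2 t.2 mn) => /eqP ? /eqP ? /eqP ?.
  by case=> -[].
have mu : \rsum_(t : 'I_m * 'I_m * 'I_m) (q ^ #|tripartite_cherry n t|) =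
    (INR m ^ 3 * q ^ 2)%R.
  by rewrite -sum_cst; apply: eq_bigr => t _; rewrite card2.
have := second_moment p01 sub; rewrite -/q mu => sm; apply: Rle_trans sm _.
have q2 : (0 <= q ^ 2)%R by apply: pow_le; lra.
have q3 : (0 <= q ^ 3)%R by apply: pow_le; lra.
have row (s : 'I_m * 'I_m * 'I_m) :
  (\rsum_(t : 'I_m * 'I_m * 'I_m)
     (q ^ #|tripartite_cherry n s :|: tripartite_cherry n t|) <=
   INR m ^ 3 * q ^ 4 + (INR m * q ^ 3 + (INR m * q ^ 3 + q ^ 2)))%R.
  (* For fixed [s], [m] indices share its first two entries, [m] share its last two, and one equals
     [s]. *)
  apply: Rle_trans (rsum_le (fun t _ => tripartite_overlap s t q01 mn)) _.
  rewrite !big_split /= sum_cst; apply: Rplus_le_compat_l.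
  apply: Rplus_le_compat; last apply: Rplus_le_compat.
  - apply: rsum_if_le => //; apply: (@card_le_range _ _ _ (fun c => (s.1, c))).
    by move=> [ab c] /eqP /= ->; exists c.
  - apply: rsum_if_le => //.
    apply: (@card_le_range _ _ _ (fun a => ((a, s.1.2), s.2))).
    by move=> [[a b] c] /andP[/eqP /= -> /eqP /= ->]; exists a.
  - rewrite -[X in (_ <= X)%R]Rmult_1_l; apply: (@rsum_if_le _ _ 1) => //.
    apply: (@card_le_range _ _ _ (fun _ : 'I_1 => s)).
    by move=> t /eqP <-; exists ord0.
apply: Rle_trans (Rplus_le_compat_r _ _ _ (rsum_le (fun s _ => row s))) _.
by rewrite sum_cst; apply: Req_le; ring.
Qed.

(** * Conditions forcing the four-vertex diameter graph *)

Lemma adjN_mem (n : nat) (E F : {set {set 'I_n}}) (x y : 'I_n) :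
  [disjoint F & E] -> [set x; y] \in F -> ~~ adj E x y.
Proof. by move=> dis xy; rewrite /adj (disjointFr dis xy) andbF. Qed.

Definition not_universal (n : nat) (o : 'I_n) (E : {set {set 'I_n}}) : Prop :=
  exists2 v, v != o & ~~ adj E o v.

Definition has_cotriangle (n : nat) (E : {set {set 'I_n}}) : Prop :=
  exists a b c : 'I_n, uniq [:: a; b; c] /\
    [&& ~~ adj E a b, ~~ adj E b c & ~~ adj E a c].

Lemma prob_not_universal (n : nat) (o : 'I_n) (p : R) :
  (0 <= p <= 1)%R -> (prob p (not_universal o) <= INR n * (1 - p))%R.
Proof.
move=> p01; have <- : INR #|'I_n| = INR n by rewrite card_ord.
rewrite -[X in (_ * X)%R]pow_1.
apply: (@union_bound _ _ _ _ (fun v => v != o) (fun v => [set [set o; v]])) => //.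
- move=> E [v vo]; rewrite /adj eq_sym vo /= => vE; exists v => //.
  by rewrite disjoints1.
- move=> v vo; apply/subsetP => e; rewrite !inE => /eqP->.
  by rewrite cards2 [o == v]eq_sym vo.
- by move=> v _; rewrite cards1.
Qed.

Lemma prob_has_cotriangle (n : nat) (p : R) :
  (0 <= p <= 1)%R -> (prob p (@has_cotriangle n) <= (INR n * (1 - p)) ^ 3)%R.
Proof.
move=> p01; rewrite Rpow_mult_distr.
have <- : INR #|{: 'I_n * 'I_n * 'I_n}| = (INR n ^ 3)%R.
  by rewrite !card_prod !card_ord !mult_INR /=; ring.
apply: (@union_bound _ _ _ _ (fun t => uniq [:: t.1.1; t.1.2; t.2])
   (fun t => [set:: [:: [set t.1.1; t.1.2]; [set t.1.2; t.2]; [set t.1.1; t.2]]])) => //.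
- move=> E [a [b [c [us]]]] /and3P[ab bc ac]; exists (a, b, c) => //=.
  move: us; rewrite /= !inE negb_or -!andbA => /and4P[nab nac nbc _].
  rewrite disjoint_subset; apply/subsetP => e; rewrite !inE.
  move: ab bc ac; rewrite /adj nab nac nbc /= => ab bc ac.
  by case/or3P => /eqP->.
- move=> [[a b] c]; rewrite /= !inE negb_or -!andbA => /and4P[nab nac nbc _].
  apply/subsetP => e; rewrite !inE.
  by case/or3P => /eqP->; rewrite cards2 ?nab ?nac ?nbc.
- move=> [[a b] c]; rewrite /= !inE negb_or -!andbA => /and4P[nab nac nbc _].
  rewrite cardsE (card_uniqP _) //= !inE negb_or -!andbA andbT.
  by apply/and3P; split; apply/eqP => /set2_inj[] [] e1 e2; subst;
    rewrite ?eqxx in nab nac nbc.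
Qed.

(** Each of [a], [b], [c] lies on a non-edge, hence differs from the universal vertex [o]; without a
    cotriangle, [a] and [c] must be adjacent. *)
Lemma cherry_event (n : nat) (E : {set {set 'I_n}}) (conn : bool)
    (o a b c : 'I_n) :
  uniq [:: a; b; c] -> [disjoint cherry a b c & E] ->
  ~ not_universal o E -> ~ has_cotriangle E -> event 2 4 conn E.
Proof.
move=> us dis univ notri.
have nab : ~~ adj E a b by apply: adjN_mem dis _; rewrite set21.
have nbc : ~~ adj E b c by apply: adjN_mem dis _; rewrite set22.
have full v : v != o -> adj E o v.
  by move=> vo; apply: contraT => nE; case: univ; exists v.
have ac : adj E a c.
  by apply: contraT => nE; case: notri; exists a, b, c; rewrite us nab nbc nE.
move: (us); rewrite /= !inE negb_or -!andbA => /and4P[ab ac' bc _].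
have bo : b != o by apply: contraNneq nab => bo; rewrite bo adjC full // -bo.
have ao : a != o by apply: contraNneq nab => ao; rewrite ao full // -ao eq_sym.
have co : c != o by apply: contraNneq nbc => co; rewrite co adjC full // -co.
apply: (@triangle_pendant_event _ _ _ o a b c) => //; try exact: full.
by rewrite cons_uniq us andbT !inE !negb_or ![o == _]eq_sym ao bo co.
Qed.

(** The target event and three failure events cover all graphs. Vertex 0 plays the role of [o], so
    its failure costs only n q. *)
Lemma prob_event4 (m n : nat) (p : R) (conn : bool) :
  (0 <= p <= 1)%R -> (m + m + m <= n.+1)%N ->
  (1 <= prob p (@event 2 n.+1 4 conn) +
    (prob p (fun E => forall t : 'I_m * 'I_m * 'I_m,
               ~~ [disjoint tripartite_cherry n t & E]) +
     (INR n.+1 * (1 - p) + (INR n.+1 * (1 - p)) ^ 3)))%R.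
Proof.
move=> p01 mn.
set A0 := fun E : {set {set 'I_n.+1}} => forall t : 'I_m * 'I_m * 'I_m, _.
have cover : (1 <= prob p (@event 2 n.+1 4 conn) + (prob p A0 +
    (prob p (@not_universal n.+1 ord0) + prob p (@has_cotriangle n.+1))))%R.
  rewrite -(expect_cst n.+1 p 1) /prob -/(expect _ _) -!expectD.
  apply: expect_le => // E; rewrite -!/(indic _).
  have := indic_ge0 (event 2 4 conn E); have := indic_ge0 (A0 E).
  have := indic_ge0 (not_universal ord0 E); have := indic_ge0 (has_cotriangle E).
  have [/indic_true->|n0] := excluded_middle_informative (A0 E); first lra.
  have [/indic_true->|n1] := excluded_middle_informative (not_universal ord0 E); first lra.
  have [/indic_true->|n2] := excluded_middle_informative (has_cotriangle E); first lra.
  suff /indic_true-> : event 2 4 conn E by lra.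
  have [t dis] : exists t : 'I_m * 'I_m * 'I_m, [disjoint tripartite_cherry n t & E].
    by apply/existsP; apply: contraT => /existsPn nt; case: n0 => t; apply: nt.
  have [ab bc ac] := tripartite_vertices_neq t.1.1 t.1.2 t.2 mn.
  by apply: cherry_event dis n1 n2; rewrite /= !inE negb_or ab ac bc.
have := prob_not_universal (ord0 : 'I_n.+1) p01.
have := prob_has_cotriangle n.+1 p01.
lra.
Qed.

(** * Numerical estimates and the conclusion *)

Lemma prob_event4_gt_half (n : nat) (p : R) (conn : bool) :
  (0 <= p <= 1)%R -> (8 <= n)%N ->
  ((1 - p) * INR n <= 1 / 100)%R ->
  (100 <= (1 - p) * (INR n * sqrt (INR n)))%R ->
  (prob p (@event 2 n 4 conn) > 1 / 2)%R.
Proof.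
case: n => // n p01 n8 small large; set N := n.+1 in n8 small large *.
set q := (1 - p)%R in small large.
pose m := N %/ 3.
have mn : (m + m + m <= N)%N.
  have -> : (m + m + m = m * 3)%N by rewrite !mulnS muln0 addn0 addnA.
  exact: leq_divM.
have nm : (INR N <= 4 * INR m)%R.
  (* From k at least 8 follows l at least 2, so the remainder r is at most l. This is the source of
     the threshold 8. *)
  have third (k l r : nat) : (8 <= k)%N -> (r < 3)%N -> k = (l * 3 + r)%N ->
      (k <= 4 * l)%coq_nat.
    by move=> /leP k8 /leP r3; rewrite -plusE -multE; lia.
  rewrite -(INR_IZR_INZ 4) -mult_INR; apply: le_INR.
  by apply: (third _ _ (N %% 3)); [exact: n8 | rewrite ltn_mod | exact: divn_eq].
have x0 : (0 < INR N)%R by apply/lt_0_INR/ltP.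
have q0 : (0 < q)%R.
  apply: Rnot_le_lt => q0.
  by have e : q = 0%R; [rewrite /q in q0 *; lra | rewrite e in large; lra].
have := prob_event4 conn p01 mn; have := prob_no_cherry p01 mn.
rewrite -/N -/q; set P0 := prob p (fun E => forall t, _).
set M := (INR m ^ 3 * q ^ 2)%R => cheb.
have m0 : (0 <= INR m)%R by exact: pos_INR.
have mN : (3 * INR m <= INR N)%R.
  by move/leP/le_INR: mn; rewrite !plus_INR; lra.
have mq : (INR m * q <= 1 / 300)%R by nra.
(* Squaring the hypothesis [large] gives q^2 n^3 >= 100^2, and n <= 4m costs the factor 64. *)
have M_large : (10000 / 64 <= M)%R.
  have sq : (sqrt (INR N) * sqrt (INR N) = INR N)%R by apply: sqrt_sqrt; lra.
  have y2 : (10000 <= q ^ 2 * INR N ^ 3)%R.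
    have -> : (q ^ 2 * INR N ^ 3 = (q * (INR N * sqrt (INR N))) *
        (q * (INR N * sqrt (INR N))))%R.
      transitivity (q ^ 2 * INR N ^ 2 * (sqrt (INR N) * sqrt (INR N)))%R; last ring.
      by rewrite sq; ring.
    by nra.
  have : (INR N ^ 3 <= (4 * INR m) ^ 3)%R by apply: pow_incr; lra.
  have : (0 < q ^ 2)%R by apply: pow_lt.
  by rewrite /M Rpow_mult_distr; nra.
(* The bound [cheb] reads P0 M^2 <= M (1 + 2mq), with [M] the mean number of cherries. *)
have P0_le : (P0 * M <= 1 + 2 * (INR m * q))%R.
  apply: (Rmult_le_reg_r M); first lra.
  move: cheb; rewrite /M; lra.
(* The failure probabilities then total at most 1/8 + 1/100 + 1/100^3, well below 1/2. *)
have P0_small : (P0 <= 1 / 8)%R by nra.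
have : ((INR N * q) ^ 3 <= (1 / 100) ^ 3)%R by apply: pow_incr; nra.
by rewrite (Rmult_comm _ q); lra.
Qed.

Theorem theorem15 (p : nat -> R)
  (Hp : forall n, (0 <= p n <= 1)%R)
  (Hq_small : Un_cv (fun n => ((1 - p n) * INR n)%R) 0%R)
  (Hq_large : cv_infty (fun n => ((1 - p n) * (INR n * sqrt (INR n)))%R)) :
  exists N : nat, forall n : nat, (N <= n)%N ->
    u_eq false 2 n (p n) 4 /\ u_eq true 2 n (p n) 4.
Proof.
have [N1 small] := Hq_small (1 / 100)%R ltac:(lra).
have [N2 large] := Hq_large 100%R.
exists (maxn 8 (maxn N1 N2)) => n; rewrite !geq_max => /and3P[n8 /leP n1 /leP n2].
have {}small : (0 <= (1 - p n) * INR n <= 1 / 100)%R.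
  have := small n n1; rewrite /R_dist Rminus_0_r => /Rabs_def2.
  have : (0 <= (1 - p n) * INR n)%R.
    by apply: Rmult_le_pos; [have := Hp n; lra | exact: pos_INR].
  lra.
have {}large := large n n2.
suff H conn : u_eq conn 2 n (p n) 4 by [].
right; split=> //; split; first by apply: prob_event4_gt_half => //; lra.
move=> k k4; have := @prob_event_large n k _ conn (Hp n) k4.
(* The bound for larger sets becomes 1024/100^5, about 10^(-7). *)
have : ((INR n * (1 - p n)) ^ 5 <= (1 / 100) ^ 5)%R.
  by apply: pow_incr; rewrite Rmult_comm.
by move=> ? ?; apply: Rle_not_gt; lra.
Qed.
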